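(* Let $X$ be a real-valued continuous random variable with probability density function $f_X$ and cumulative distribution function $F_X(x)=P(X\le x)$. Then the information-weighted density $f_{IX}(x)=-f_X(x)\log F_X(x)$ is a valid probability density, i.e. (i) $f_{IX}(x)\ge 0$ for all $x\in\mathbb{R}$, and (ii) $\int_{-\infty}^{\infty} f_{IX}(x)\,dx=1$.
   Context: ''Continuous random variable'' means that the law of $X$ has a density $f_X$ with respect to Lebesgue measure. $\log$ is the natural logarithm. The information-weighted (or information-conjugated) density of $X$ is defined by $f_{IX}(x):=-f_X(x)\cdot\log F_X(x)$, with the convention $f_{IX}(x)=0$ at points where $F_X(x)=0$. *)

(* Defs.v *)
From HB Require Import structures.
From mathcomp Require Import all_boot all_order all_algebra.
From mathcomp Require Import all_classical all_reals all_analysis.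

Set Implicit Arguments.
Unset Strict Implicit.
Unset Printing Implicit Defensive.

Import Order.TTheory GRing.Theory Num.Theory.
Import numFieldNormedType.Exports.

Local Open Scope classical_set_scope.
Local Open Scope ring_scope.

(* [f] is a density of the law of [X] with respect to Lebesgue measure; a
   random variable is continuous when it admits such an [f]. *)
Definition is_density_of (R : realType) (d : measure_display)
    (T : measurableType d) (P : probability T R) (X : {RV P >-> R})
    (f : R -> R) : Prop :=
  [/\ measurable_fun setT f,
      (forall x, 0 <= f x) &
      forall A : set R, measurable A ->
        distribution P X A = (\int[lebesgue_measure]_(x in A) (f x)%:E)%E].

(* Measurability is explicit because the library's integral is total: it has a
   value, without being meaningful, on non-measurable functions. *)
Definition is_probability_density (R : realType) (f : R -> R) : Prop :=
  [/\ measurable_fun setT f,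
      (forall x, 0 <= f x) &
      (\int[lebesgue_measure]_x (f x)%:E = 1)%E].

(* [cdf X x] is the extended real P(X <= x); [fine] turns it into a real, with
   no loss since it lies in [0, 1]. *)
Definition info_density (R : realType) (d : measure_display)
    (T : measurableType d) (P : probability T R) (X : {RV P >-> R})
    (f : R -> R) (x : R) : R :=
  let F := fine (cdf X x) in
  if F == 0 then 0 else - f x * ln F.

(* Main.v *)
(* Layer-cake proof: f_IX = (-log F) f, so its integral is E[-log F(X)], the
   integral over r > 0 of P(-log F(X) > r) = P(0 < F(X) < e^-r). Since the law
   of X has no atoms, F(X) is uniform on [0, 1], so this tail is e^-r, the
   density of the exponential distribution of rate 1. *)
Require Import Defs.
From HB Require Import structures.
From mathcomp Require Import all_boot all_order all_algebra.
From mathcomp Require Import all_classical all_reals all_analysis.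
From mathcomp Require Import measurable_realfun lra.

Import Order.TTheory GRing.Theory Num.Theory.
Import numFieldNormedType.Exports.

Local Open Scope classical_set_scope.
Local Open Scope ring_scope.

(** Integrals of [f] vanish on [mu]-null sets, so [nu] is dominated by [mu]; [f] then agrees
    [mu]-a.e. with the Radon-Nikodym derivative, for which change of variables is known. *)
Lemma ge0_integral_density (d : measure_display) (T : measurableType d)
    (R : realType) (nu : {finite_measure set T -> \bar R})
    (mu : {sigma_finite_measure set T -> \bar R}) (f g : T -> R) :
  measurable_fun setT f -> (forall x, 0 <= f x) ->
  (forall A, measurable A -> nu A = (\int[mu]_(x in A) (f x)%:E)%E) ->
  measurable_fun setT g -> (forall x, 0 <= g x) ->
  (\int[mu]_x (g x * f x)%:E = \int[nu]_x (g x)%:E)%E.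
Proof.
move=> mf f0 fE mg g0.
have mfE : measurable_fun setT (EFin \o f) by exact/measurable_EFinP.
have dom : nu `<< mu.
  apply/null_content_dominatesP => A mA A0; rewrite fE//.
  by apply: null_set_integral => //; exact: measurable_funS mfE.
have iRN := Radon_Nikodym_SigmaFinite.f_integrable dom.
rewrite -(Radon_Nikodym_SigmaFinite.change_of_variables dom)//;
  [|exact/measurable_EFinP].
apply: ae_eq_integral => //.
- exact/measurable_EFinP/measurable_funM.
- apply: emeasurable_funM; first exact/measurable_EFinP.
  exact: measurable_int iRN.
- suff fRN : ae_eq mu setT (EFin \o f) (Radon_Nikodym_SigmaFinite.f nu mu).
    exact: (ae_eqe_mul2l (EFin \o g) fRN).
  apply: ae_eq_sym; apply: integral_ae_eq => // A _ mA.
  by rewrite -fE// (Radon_Nikodym_SigmaFinite.f_integral dom).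
Qed.

(* [R] and [measurableTypeR R] have the same measurable sets but distinct
   measure displays, so the law of [X] is not syntactically comparable with
   [lebesgue_measure]: both integrals are instead reduced to one over [P]. *)
Lemma ge0_integral_RV_density (R : realType) (d : measure_display)
    (T : measurableType d) (P : probability T R) (X : {RV P >-> R})
    (f g : R -> R) :
  is_density_of X f -> measurable_fun setT g -> (forall x, 0 <= g x) ->
  (\int[lebesgue_measure]_x (g x * f x)%:E =
   \int[distribution P X]_x (g x)%:E)%E.
Proof.
move=> [mf f0 fE] mg g0.
have mX : measurable_fun setT (X : T -> measurableTypeR R).
  exact: (measurable_funPT X).
pose X' : {mfun T >-> measurableTypeR R} :=
  HB.pack (X : T -> measurableTypeR R) (isMeasurableFun.Build _ _ _ _ _ mX).
transitivity (\int[distribution P X']_x (g x)%:E)%E.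
  exact: (ge0_integral_density _ _ _ (distribution P X') lebesgue_measure
    _ _ mf f0 fE mg g0).
have mgE : measurable_fun setT (EFin \o g) by exact/measurable_EFinP.
by rewrite !ge0_integral_distribution// => x; rewrite lee_fin.
Qed.

Section fine_cdf.
Context {R : realType} {d : measure_display} {T : measurableType d}.
Context {P : probability T R} (X : {RV P >-> R}).

Lemma cdf_fin_num (x : R) : cdf X x \is a fin_num.
Proof. exact: fin_num_measure. Qed.

Lemma measurable_fine_cdf : measurable_fun setT (fun x => fine (cdf X x)).
Proof. by apply: measurableT_comp => //; exact: cdf_measurable. Qed.

Lemma measurable_cdf_lt (u : R) : measurable [set x | fine (cdf X x) < u].
Proof.
have := measurable_fine_cdf measurableT `]-oo, u[%classic (measurable_itv _).
by rewrite setTI set_itvNyo.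
Qed.

Lemma measurable_cdf_eq0 : measurable [set x | fine (cdf X x) = 0].
Proof.
by have := measurable_fine_cdf measurableT [set 0] (measurable_set1 _);
  rewrite setTI.
Qed.

End fine_cdf.

Section density.
Context {R : realType} {d : measure_display} {T : measurableType d}.
Context {P : probability T R} {X : {RV P >-> R}} {f : R -> R}.
Context (hf : is_density_of X f).

Local Notation F := (fun x => fine (cdf X x)).

(** Absence of atoms: Lebesgue integrals of the density ignore the endpoint [a]. *)
Lemma distribution_itvNyo (a : R) : distribution P X `]-oo, a[ = cdf X a.
Proof.
have [mf f0 fE] := hf.
rewrite /cdf !fE// integral_itv_bndo_bndc//.
by apply: measurable_funTS; exact/measurable_EFinP.
Qed.

(** By monotonicity of [F] and right-continuity at [a = sup S], the sublevel set [S] is an open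
    half-line ending at [a]. No inverse of [F] is involved, so flat stretches are harmless. *)
Lemma distribution_cdf_lt (u : R) : 0 < u < 1 ->
  distribution P X [set x | F x < u] = u%:E.
Proof.
move=> /andP[u0 u1].
set S := [set x | F x < u].
have ndF x y : x <= y -> F x <= F y.
  by move=> xy; apply: fine_le; rewrite ?cdf_fin_num//; exact: cdf_nondecreasing.
have F0 : F @ -oo --> (0:R) by apply: fine_cvg; exact: cvg_cdfNy0.
have F1 : F @ +oo --> (1:R) by apply: fine_cvg; exact: cvg_cdfy1.
have [x0 Sx0] : exists x, S x.
  by near (ninfty_nbhs R) => x; exists x; near: x; exact: (@cvgr_lt _ _ _ _ _ _ F0).
have [b Sb] : exists b, u < F b.
  by near (pinfty_nbhs R) => x; exists x; near: x; exact: (@cvgr_gt _ _ _ _ _ _ F1).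
have hS : has_sup S.
  split; [by exists x0|exists b => x Sx].
  rewrite leNgt; apply/negP => /ltW/ndF.
  move: Sx Sb; rewrite /S/=; lra.
set a := sup S.
(* Otherwise right-continuity would put a point beyond [a] in [S]. *)
have Fa : u <= F a.
  rewrite leNgt; apply/negP => Fau.
  have rc : F x @[x --> a^'+] --> F a.
    by apply: fine_cvg; rewrite fineK ?cdf_fin_num//; exact: cdf_right_continuous.
  have [c [ac Fc]] : exists c, a < c /\ F c < u.
    near a^'+ => c; exists c; split; first by near: c; exact: nbhs_right_gt.
    by near: c; exact: (@cvgr_lt _ _ _ _ _ _ rc u Fau).
  by have := sup_upper_bound hS Fc; rewrite leNgt ac.
have SE : S = `]-oo, a[%classic.
  apply/seteqP; split=> x /=; rewrite in_itv/=.
    move=> Sx; rewrite ltNge; apply/negP => /ndF; move: Sx Fa; rewrite /S/=; lra.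
  move=> xa; have [y Sy xy] := sup_gt (ex_intro _ x0 Sx0) xa.
  by apply: le_lt_trans Sy; apply: ndF; exact: ltW.
apply/eqP; rewrite eq_le; apply/andP; split; last first.
  by rewrite SE distribution_itvNyo -[X in (_ <= X)%E]fineK ?cdf_fin_num// lee_fin.
(* For the upper bound, exhaust [S] from below by closed half-lines, whose mass is a value of [F] by
   definition. Each endpoint is strictly below [a], hence in [S], so that value is less than [u]. *)
pose G n := `]-oo, a - n.+1%:R^-1]%classic.
have GS : \bigcup_n G n = S.
  rewrite SE; apply/seteqP; split=> x /=.
    move=> [n _]; rewrite /G /= !in_itv/= => /le_lt_trans; apply.
    by rewrite ltrBlDr ltrDl invr_gt0.
  rewrite in_itv/= => /ltr_add_invr[n xn]; exists n => //.
  by rewrite /G/= in_itv/= lerBrDr ltW.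
have cvgG : (distribution P X \o G) @ \oo --> distribution P X S.
  rewrite -GS; apply: nondecreasing_cvg_mu => [n||m n mn].
  - exact: measurable_itv.
  - by rewrite GS SE; exact: measurable_itv.
  - apply/subsetPset => x; rewrite /G/= !in_itv/= => /le_trans; apply.
    by rewrite lerD2l lerN2 lef_pV2 ?posrE// ler_nat.
apply: cvge_le cvgG; apply: nearW => n /=.
have : S (a - n.+1%:R^-1) by rewrite -GS; exists n => //; rewrite /G/= in_itv/=.
by move=> /ltW; rewrite -lee_fin fineK// cdf_fin_num.
Unshelve. all: by end_near.
Qed.

(** The zero set of [F] lies in sublevel sets of arbitrarily small mass [u]. *)
Lemma distribution_cdf_eq0 : distribution P X [set x | F x = 0] = 0%E.
Proof.
apply/eqP; rewrite eq_le measure_ge0 andbT.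
apply/lee_addgt0Pr => e e0; rewrite add0e.
(* The cap at one half keeps [u] below 1 when [e] is large. *)
set u := Num.min e 2^-1.
have u01 : 0 < u < 1 by rewrite lt_min e0 gt_min invf_lt1 ?ltr1n//= invr_gt0 ltr0n orbT.
have ue : (u%:E <= e%:E)%E by rewrite lee_fin ge_min lexx.
apply: le_trans ue; rewrite -(distribution_cdf_lt _ u01).
apply: le_measure; rewrite ?inE.
- exact: measurable_cdf_eq0.
- exact: measurable_cdf_lt.
- by move=> x /= ->; case/andP: u01.
Qed.

End density.

Section neg_ln_cdf.
Context {R : realType} {d : measure_display} {T : measurableType d}.
Context {P : probability T R} (X : {RV P >-> R}).

(** To be seen as a random variable on the real line under the law of [X]. As [ln 0 = 0], it
    vanishes where the cdf does. *)
Definition neg_ln_cdf (x : R) : R := - ln (fine (cdf X x)).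

Lemma measurable_neg_ln_cdf : measurable_fun setT neg_ln_cdf.
Proof.
apply: measurableT_comp => //; apply: measurableT_comp => //.
exact: measurable_fine_cdf.
Qed.

HB.instance Definition _ :=
  isMeasurableFun.Build _ _ _ _ neg_ln_cdf measurable_neg_ln_cdf.

Lemma neg_ln_cdf_ge0 (x : R) : 0 <= neg_ln_cdf x.
Proof.
rewrite oppr_ge0 ln_le0// -lee_fin fineK ?cdf_fin_num//; exact: cdf_le1.
Qed.

End neg_ln_cdf.

Section uniformization.
Context {R : realType} {d : measure_display} {T : measurableType d}.
Context {P : probability T R} {X : {RV P >-> R}} {f : R -> R}.
Context (hf : is_density_of X f).

Lemma ccdf_neg_ln_cdf (r : R) : 0 < r ->
  ccdf (neg_ln_cdf X : {RV distribution P X >-> R}) r = (expR (- r))%:E.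
Proof.
move=> r0.
have u01 : 0 < expR (- r) < 1 by rewrite expR_gt0 expR_lt1 oppr_lt0.
have F0 x : 0 <= fine (cdf X x) by rewrite fine_ge0.
rewrite -(distribution_cdf_lt hf _ u01) /ccdf /distribution /= {1}/pushforward.
pose S := [set x | fine (cdf X x) < expR (- r)].
pose Z := [set x | fine (cdf X x) = 0].
(* Points of [Z] belong to [S], but there [neg_ln_cdf] takes the default value 0, below [r].
   Removing them costs no mass, since [Z] is null. *)
have -> : neg_ln_cdf X @^-1` `]r, +oo[ = S `\` Z.
  apply/seteqP; split=> x; rewrite /S /Z /neg_ln_cdf /= in_itv/= andbT.
    move=> rF; have Fx0 : 0 < fine (cdf X x).
      rewrite lt_neqAle F0 andbT; apply/eqP => Fx; move: rF.
      by rewrite -Fx ln0// oppr0 ltNge (ltW r0).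
    split; last by apply/eqP; rewrite gt_eqF.
    by rewrite -[X in X < _]lnK ?posrE// ltr_expR ltrNr.
  move=> [Fr /eqP Fx]; rewrite ltrNr -ltr_expR lnK// posrE lt_neqAle eq_sym Fx.
  exact: F0.
have mS : measurable S by exact: measurable_cdf_lt.
have mZ : measurable Z by exact: measurable_cdf_eq0.
rewrite -[LHS]/(distribution P X _) measureD//; last first.
  by rewrite ltey_eq fin_num_measure.
rewrite [X in (_ - X)%E](_ : _ = 0%E) ?sube0//.
apply/eqP; rewrite eq_le measure_ge0 andbT -(distribution_cdf_eq0 hf).
by apply: le_measure; rewrite ?inE//; exact: measurableI.
Qed.

Lemma expectation_neg_ln_cdf :
  (\int[distribution P X]_x (neg_ln_cdf X x)%:E = 1)%E.
Proof.
have := @ge0_expectation_ccdf _ _ _ (distribution P X) (neg_ln_cdf X)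
  (neg_ln_cdf_ge0 X).
rewrite unlock => ->.
(* The endpoint 0 is dropped because the tail formula is available only for [r > 0]. *)
rewrite -integral_itv_obnd_cbnd; last first.
  by apply: measurable_funTS; exact: ccdf_measurable.
transitivity (\int[@lebesgue_measure R]_(r in `]0%R, +oo[)
    (exponential_pdf 1 r)%:E)%E.
  apply: eq_integral => r /set_mem rI.
  have r0 : 0 < r by move: rI; rewrite /= in_itv/= andbT.
  by rewrite ccdf_neg_ln_cdf// exponential_pdfE ?ltW// mul1r mulN1r.
rewrite integral_itv_obnd_cbnd; last first.
  by apply/measurable_funTS/measurable_EFinP; exact: measurable_exponential_pdf.
(* The exponential density is zero on negative reals, so its total mass 1 is already attained on the
   half-line. *)
rewrite -(@integral_exponential_pdf R 1)// integral_mkcond.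
apply: eq_integral => r _; rewrite patchE; case: ifPn => //.
rewrite notin_setE/= in_itv/= andbT => /negP; rewrite -ltNge => r0.
by rewrite lt0_exponential_pdf.
Qed.

End uniformization.

Theorem proposition1p3 (R : realType) (d : measure_display)
    (T : measurableType d) (P : probability T R) (X : {RV P >-> R})
    (fX : R -> R) (hfX : is_density_of X fX) :
  is_probability_density (info_density X fX).
Proof.
have [mf f0 _] := hfX.
have -> : info_density X fX = fun x => neg_ln_cdf X x * fX x.
  apply/funext => x; rewrite /info_density /neg_ln_cdf.
  (* The default [ln 0 = 0] matches the convention in [info_density], so the identity holds at every
     point. *)
  case: eqP => [->|_]; first by rewrite ln0// oppr0 mul0r.
  by rewrite mulrC mulrN mulNr.
have mg := measurable_neg_ln_cdf X.
split; first exact: measurable_funM.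
  by move=> x; rewrite mulr_ge0// neg_ln_cdf_ge0.
rewrite -(expectation_neg_ln_cdf hfX).
exact: ge0_integral_RV_density hfX mg (neg_ln_cdf_ge0 X).
Qed.
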